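(* Let $K$ be a field, $S=K[x_1,\ldots,x_n]$, and let $I\subset S$ be a transversal polymatroidal ideal. Then $\operatorname{astab}(I)=1$, that is, $\operatorname{Ass}(I)=\operatorname{Ass}^{\infty}(I)$.
   Context: For a non-empty subset $F\subset[n]=\{1,\ldots,n\}$, $P_F=(x_i : i\in F)$. A transversal polymatroidal ideal is an ideal of the form $I=P_{F_1}\cdots P_{F_r}$, where $r\ge1$ and $F_1,\ldots,F_r$ is a collection of non-empty, not necessarily distinct, subsets of $[n]$. $\operatorname{Ass}(J)$ denotes the set of associated prime ideals of $S/J$. By Brodmann, $\operatorname{Ass}(I^k)$ is constant for $k\gg0$, and $\operatorname{Ass}^\infty(I)$ is this stable value. $\operatorname{astab}(I)$ is the smallest integer $k_1\ge1$ such that $\operatorname{Ass}(I^k)=\operatorname{Ass}(I^{k_1})$ for all $k\ge k_1$. *)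

(* Defs.v *)
From mathcomp Require Import all_boot all_algebra ring_quotient.
From mathcomp Require Import mpoly.
From mathcomp Require Import boolp classical_sets.

Set Implicit Arguments.
Unset Strict Implicit.
Unset Printing Implicit Defensive.

Import GRing.Theory.

Local Open Scope classical_set_scope.
Local Open Scope ring_scope.

(* Ideals are classical sets of ring elements, and the unit ideal is [setT]
   ([idealr] only covers proper ideals with a boolean membership test). *)
Section Ideals.
Variable R : comNzRingType.
Implicit Types (G I J P : set R) (k : nat).

Definition ideal_gen G : set R :=
  [set f | exists m (a g : 'I_m -> R),
             (forall i, G (g i)) /\ f = \sum_(i < m) a i * g i].

Definition ideal_mul I J : set R := ideal_gen [set x * y | x in I & y in J].

(* As for [^+] on rings: [ideal_exp I 1] is convertible to [I]. *)
Definition ideal_exp I k : set R := iterop k ideal_mul I setT.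

(* [idealr_closed] includes properness. *)
Definition prime_ideal P : Prop :=
  idealr_closed (mem P) /\ prime_idealr_closed (mem P).

(* The colon ideal (J : f), which is the annihilator of the class of f in R/J. *)
Definition colon J (f : R) : set R := [set g | J (g * f)].

Definition Ass J : set (set R) :=
  [set P | prime_ideal P /\ exists f, P = colon J f].

(* 0 is a junk value, taken only if the sequence Ass (I^k) never stabilizes. *)
Definition astab I : nat :=
  let stable_from k1 :=
    (1 <= k1)%N /\
    forall k, (k1 <= k)%N -> Ass (ideal_exp I k) = Ass (ideal_exp I k1) in
  xget 0%N [set k1 | stable_from k1 /\ forall k, stable_from k -> (k1 <= k)%N].

(* The empty set is a junk value, taken only if there is no stable value. *)
Definition Ass_infty I : set (set R) :=
  xget set0 [set A | exists k0, forall k, (k0 <= k)%N ->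
                       Ass (ideal_exp I k) = A].

End Ideals.

Section Transversal.
Variables (K : fieldType) (n : nat).

Definition monomial_prime (F : {set 'I_n}) : set {mpoly K[n]} :=
  ideal_gen [set 'X_i | i in [set` F]].

Definition transversal_polymatroidal (I : set {mpoly K[n]}) : Prop :=
  exists (r : nat) (F : 'I_r -> {set 'I_n}),
    [/\ (1 <= r)%N, forall i, F i != finset.set0
      & I = \big[@ideal_mul {mpoly K[n]}/setT]_(i < r) monomial_prime (F i)].

End Transversal.

(* Main.v *)
(* Let s be the family of the F_i and I_s the product of the P_F, F in s. By a
   Hall-type theorem the monomial x^m lies in I_s iff, for every set U of
   variables, #{F in s | F <= U} is at most the U-degree of m; the sets U that are
   connected by the F in s contained in U suffice. Hence I_s is the intersection
   of the P_U-primary ideals P_U^#{F in s | F <= U} over the connected U, so every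
   associated prime is such a P_U. Conversely, for U connected, a spanning tree of
   the edges inside U yields a monomial x^v with (I_s : x^v) = P_U. Connectedness
   does not see multiplicities in s, and I_s^k repeats every F exactly k times. *)
Require Import Defs.
From mathcomp Require Import all_boot all_algebra.
From mathcomp Require Import mpoly classical_sets.
From mathcomp Require Import boolp zify.
From mathcomp Require Import fintype finset.

Set Implicit Arguments.
Unset Strict Implicit.
Unset Printing Implicit Defensive.

Import GRing.Theory.

(** * Exponent vectors: Hall-type criterion and connected sets of variables *)

Section Monomials.
Variable n : nat.
Implicit Types (F U V : {set 'I_n}) (s t : seq {set 'I_n}) (m u : 'X_{1..n}).

Definition degm U m := \sum_(j in U) m j.

Definition nsub s U := count (fun F => F \subset U) s.

(* The exponents of the monomials in the product of the primes P_F, F in s. *)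
Fixpoint prodexp s m : Prop :=
  if s is F :: s' then exists j m', [/\ j \in F, m = (U_(j) + m')%MM & prodexp s' m']
  else True.

Lemma degmD U m1 m2 : degm U (m1 + m2)%MM = degm U m1 + degm U m2.
Proof. by rewrite /degm -big_split; apply: eq_bigr => j _; rewrite mnmDE. Qed.

Lemma degm1 U j : degm U U_(j)%MM = (j \in U).
Proof.
rewrite /degm; case: (boolP (j \in U)) => jU.
  rewrite (bigD1 j) //= mnm1E eqxx big1 // => i /andP[_ ij].
  by rewrite mnm1E eq_sym (negbTE ij).
by rewrite big1 // => i iU; rewrite mnm1E; case: eqP => // ji; rewrite ji iU in jU.
Qed.

Lemma degmID U V m : degm U m = degm (U :&: V) m + degm (U :\: V) m.
Proof. exact: big_setID. Qed.

Lemma degm_gt0P U m : reflect (exists2 j, j \in U & 0 < m j) (0 < degm U m).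
Proof.
rewrite lt0n sum_nat_eq0 negb_forall.
apply: (iffP existsP) => [[j]|[j jU mj]]; last by exists j; rewrite jU -lt0n.
by rewrite negb_imply -lt0n => /andP[jU mj]; exists j.
Qed.

Definition mrestr U m : 'X_{1..n} := [multinom (if j \in U then m j else 0) | j < n].

Lemma degm_restr U V m : degm V (mrestr U m) = degm (V :&: U) m.
Proof.
rewrite /degm big_mkcond [RHS]big_mkcond /=; apply: eq_bigr => j _.
by rewrite mnmE inE; do 2 case: (j \in _).
Qed.

Lemma mrestrK U m : (mrestr U m + mrestr (~: U) m)%MM = m.
Proof.
by apply/mnmP => j; rewrite mnmDE !mnmE inE; case: (j \in U); rewrite ?addn0.
Qed.

Lemma mnm_predK m j : 0 < m j -> m = (U_(j) + (m - U_(j)))%MM.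
Proof.
by move=> mj; rewrite addmC submK // lep1mP -lt0n.
Qed.

Lemma prodexpDr s m u : prodexp s m -> prodexp s (m + u)%MM.
Proof.
elim: s m => //= F s IHs m [j [m' [jF -> /IHs sm']]].
by exists j, (m' + u)%MM; rewrite addmA.
Qed.

Lemma prodexp_cat s t m1 m2 :
  prodexp s m1 -> prodexp t m2 -> prodexp (s ++ t) (m1 + m2)%MM.
Proof.
elim: s m1 => [|F s IHs] m1 /=; first by rewrite addmC => _; apply: prodexpDr.
move=> [j [m' [jF -> sm' tm2]]]; exists j, (m' + m2)%MM.
by rewrite addmA; split=> //; apply: IHs.
Qed.

Lemma prodexp_catV s t m :
  prodexp (s ++ t) m -> exists m1 m2, [/\ m = (m1 + m2)%MM, prodexp s m1 & prodexp t m2].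
Proof.
elim: s m => [|F s IHs] m /=; first by exists 0%MM, m; rewrite add0m.
move=> [j [m' [jF -> /IHs[m1 [m2 [-> sm1 tm2]]]]]].
by exists (U_(j) + m1)%MM, m2; rewrite addmA; split=> //; exists j, m1.
Qed.

Lemma prodexp_filter (a : pred {set 'I_n}) s m1 m2 :
    prodexp (filter a s) m1 -> prodexp (filter (predC a) s) m2 ->
  prodexp s (m1 + m2)%MM.
Proof.
elim: s m1 m2 => //= F s IHs m1 m2; case: (a F) => /= [|sm1].
  move=> [j [m' [jF -> sm']]] sm2; exists j, (m' + m2)%MM.
  by rewrite addmA; split=> //; apply: IHs.
move=> [j [m' [jF -> sm']]]; exists j, (m1 + m')%MM.
by rewrite Monoid.mulmCA; split=> //; apply: IHs.
Qed.

Lemma nsub_cons F s U : nsub (F :: s) U = (F \subset U) + nsub s U.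
Proof. by []. Qed.

Lemma prodexp_nsub s m : prodexp s m -> forall U, nsub s U <= degm U m.
Proof.
elim: s m => [//|F s IHs m [j [m' [jF -> /IHs sm']]] U].
rewrite nsub_cons degmD degm1 leq_add //.
by case: (boolP (F \subset U)) => // FU; rewrite (subsetP FU).
Qed.

Lemma nsub_filter (a : pred {set 'I_n}) s U :
  nsub (filter a s) U = count (fun F => (F \subset U) && a F) s.
Proof. by rewrite /nsub count_filter. Qed.

(* Halmos-Vaughan: either no proper subfamily is tight and any choice works for
   the first factor, or the factors inside a tight U are served by the variables
   of U and the other factors by the remaining variables. *)
Lemma nsub_prodexp s m : (forall U, nsub s U <= degm U m) -> prodexp s m.
Proof.
move: {2}(size s) (leqnn (size s)) => N.
elim: N s m => [|N IHN] [|F s] m // szs hall.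
case: (pselect (exists U, [/\ 0 < nsub (F :: s) U, nsub (F :: s) U < size (F :: s)
                            & nsub (F :: s) U = degm U m])).
  move: (F :: s) szs hall => {F}s szs hall [U [U_gt0 U_lt tightU]].
  rewrite -(mrestrK U m); apply: (@prodexp_filter (fun F => F \subset U)).
    apply: IHN => [|V].
      by rewrite size_filter -ltnS; apply: leq_trans szs.
    rewrite degm_restr; apply: leq_trans (hall _).
    by rewrite nsub_filter; apply: sub_count => G /=; rewrite subsetI.
  apply: IHN => [|V].
    rewrite size_filter; have := count_predC (fun F => F \subset U) s.
    by move: U_gt0 szs; rewrite /nsub; lia.
  (* Adding the tight value [degm U m] to both sides reduces the claim to the Hall bound for
     [U :|: V]: the factors inside [U] and those inside [V] but not [U] form two disjoint families
     inside the union. *)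
  rewrite degm_restr -setDE -(leq_add2l (degm U m)).
  have -> : degm U m + degm (V :\: U) m = degm (U :|: V) m.
    rewrite [RHS](degmID _ U) setDUl setDv set0U.
    by rewrite (setIidPr _) ?subsetUl.
  apply: leq_trans (hall _); rewrite -tightU /nsub count_filter -count_predUI.
  rewrite (@eq_count _ (predI _ _) pred0) ?count_pred0 ?addn0; last first.
    by move=> G /=; case: (G \subset U); rewrite ?andbF.
  apply: sub_count => G /= /orP[GU|/andP[GV _]].
    exact: subset_trans GU (subsetUl _ _).
  exact: subset_trans GV (subsetUr _ _).
move=> ntight; have /degm_gt0P[j jF mj] : 0 < degm F m.
  by apply: leq_trans (hall F); rewrite nsub_cons subxx.
exists j, (m - U_(j))%MM; rewrite -mnm_predK //; split=> //; apply: IHN => // U.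
have := degmD U U_(j) (m - U_(j)); rewrite -mnm_predK // degm1.
have := hall U; rewrite nsub_cons.
case: (posnP (nsub s U)) => [->//|sU_gt0].
case: (boolP (F \subset U)) => [/subsetP FU|FU]; first by rewrite FU //; lia.
(* Removing [U_(j)] can only break the bound at a [U] where equality held; since [F] is not inside
   [U], the family inside [U] would be proper and tight. *)
move=> /= hU dU; have [tight|ntightU] := eqVneq (nsub s U) (degm U m); last first.
  by case: (j \in U) dU; lia.
case: ntight; exists U; rewrite nsub_cons (negbTE FU) add0n; split=> //.
by rewrite ltnS count_size.
Qed.

(* Connectedness of the hypergraph on the vertex set [U] with edges the F in s
   contained in [U]. *)
Definition connected_in s U :=
  (exists2 F, F \in s & F \subset U) /\
  forall V, V \proper U -> V != set0 ->
    exists F, [/\ F \in s, F \subset U, ~~ (F \subset V) & ~~ [disjoint F & V]].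

Lemma eq_connected_in s t U : s =i t -> connected_in s U -> connected_in t U.
Proof.
move=> st [[F Fs FU] cross]; split; first by exists F; rewrite -?st.
by move=> V VU V0; have [G [Gs]] := cross V VU V0; exists G; rewrite -st.
Qed.

(** If [U] is not connected, some [V] splits it so that every F inside [U] lies in [V] or in
    [U :\: V]. The bound at [U] is then implied by the bounds at these two smaller sets, and
    induction on the cardinality applies. *)
Lemma prodexpP s m :
  (forall U, connected_in s U -> nsub s U <= degm U m) <-> prodexp s m.
Proof.
split=> [hconn|/prodexp_nsub hall U _]; last exact: hall.
apply: nsub_prodexp => U.
move: {2}#|U| (leqnn #|U|) => N.
elim: N U => [|N IHN] U szU.
  have [->|] := posnP (nsub s U); first by [].
  rewrite -has_count => /hasP[F Fs FU]; apply: hconn; split; first by exists F.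
  by move=> V /proper_card; lia.
have [->//|sU_gt0] := posnP (nsub s U).
case: (pselect (connected_in s U)) => [/hconn//|nconn].
have [V [VU V0 ncross]] : exists V, [/\ V \proper U, V != set0 &
    forall F, F \in s -> F \subset U -> (F \subset V) || [disjoint F & V]].
  apply: contra_notP nconn => nV; split.
    by move: sU_gt0; rewrite -has_count => /hasP[F Fs FU]; exists F.
  move=> V VU V0; apply: contra_notP nV => nF; exists V; split=> // F Fs FU.
  apply/negPn/negP; rewrite negb_or => /andP[FV FdV]; case: nF.
  by exists F; split.
have sVU := proper_sub VU.
rewrite (degmID U V) (setIidPr sVU).
have : nsub s U <= nsub s V + nsub s (U :\: V).
  rewrite /nsub -count_predUI; apply: leq_trans (leq_addr _ _).
  rewrite (@eq_in_count _ _ (predI (mem s) (fun F => F \subset U))); last first.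
    by move=> F Fs /=; rewrite Fs.
  by apply: sub_count => F /= /andP[Fs FU]; rewrite subsetD FU ncross.
move/leq_trans; apply; apply: leq_add; apply: IHN.
  by move/proper_card: VU; lia.
have := cardsID V U; rewrite (setIidPr sVU).
by move: V0; rewrite -card_gt0; lia.
Qed.

(** The edges inside [U] can be listed so that each new one meets the union of the earlier ones. One
    shared vertex per new edge goes into [u], which makes its degree one less than the number of
    edges; any further vertex of [U] completes the choice. *)
Lemma connected_tree s U : (forall F, F \in s -> F != set0) ->
    connected_in s U ->
  exists2 u, degm U u < nsub s U &
    forall j, j \in U -> prodexp [seq F : {set _} <- s | F \subset U] (u + U_(j))%MM.
Proof.
move=> s_nz [[F0 F0s F0U] cross].
pose sU := [seq F : {set _} <- s | F \subset U].
have sUP F : F \in sU = (F \subset U) && (F \in s) by rewrite mem_filter.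
(* Here [t] is the list of the edges used so far, [t'] the remaining ones, and [B] the region
   covered by [t]. *)
suff grow k : k < size sU -> exists t t' B u,
    [/\ perm_eq sU (t ++ t'), size t = k.+1 & B != set0] /\
    [/\ forall F, F \in t -> F \subset B, B \subset U, degm U u = k
       & forall j, j \in B -> prodexp t (u + U_(j))%MM].
  have sz : 0 < size sU by rewrite size_filter -has_count; apply/hasP; exists F0.
  have [|t [t' [B [u [[st szt B0] [tB BU du Bu]]]]]] := grow (size sU).-1.
    by rewrite prednK.
  have t'0 : t' = [::].
    apply/nilP; rewrite /nilp; move/perm_size: st; rewrite size_cat szt prednK //.
    by move/eqP; rewrite -{1}[size sU]addn0 eqn_add2l eq_sym.
  rewrite {}t'0 cats0 in st.
  exists u; first by rewrite du /nsub -size_filter prednK.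
  (* The Hall bounds depend only on counts, so they transport membership from [t] to its permutation
     [sU]. *)
  move=> j jU; apply: nsub_prodexp => V.
  rewrite /nsub (permP st); apply: prodexp_nsub; apply: Bu.
  have [BeU|] := eqVneq B U; first by rewrite BeU.
  rewrite eqEsubset BU /= => UB.
  have [//|//|F [Fs FU FB _]] := cross B; first by rewrite properE BU.
  by case/negP: FB; apply: tB; rewrite -(perm_mem st) sUP FU.
elim: k => [_|k IHk ltk].
  have F0sU : F0 \in sU by rewrite sUP F0U.
  exists [:: F0], (rem F0 sU), F0, 0%MM; split.
    by split; rewrite ?perm_to_rem ?s_nz.
  split=> // [F|| j jF]; first by rewrite inE => /eqP ->.
    by rewrite /degm big1 // => j _; rewrite mnm0E.
  by exists j, 0%MM; rewrite addmC.
have [|t [t' [B [u [[st szt B0] [tB BU du Bu]]]]]] := IHk; first exact: ltnW.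
(* When [B] is all of [U], any remaining edge meets it, being non-empty; otherwise connectedness
   gives an edge leaving [B], which cannot be in [t]. *)
have [F [Ft' FB]] : exists F, F \in t' /\ ~~ [disjoint F & B].
  have [BeU|] := eqVneq B U.
    have : 0 < size t'.
      move: ltk; rewrite (perm_size st) size_cat szt.
      by rewrite -{1}[k.+1]addn0 ltn_add2l.
    case: t' st => // F t' st _; exists F; rewrite inE eqxx; split=> //.
    have := perm_mem st F; rewrite mem_cat inE eqxx orbT sUP => /andP[FU Fs].
    have /set0Pn[j jF] := s_nz _ Fs.
    by apply/pred0Pn; exists j => /=; rewrite jF BeU (subsetP FU).
  rewrite eqEsubset BU /= => UB.
  have [//|//|F [Fs FU nFB FB]] := cross B; first by rewrite properE BU.
  exists F; split=> //.
  have := perm_mem st F; rewrite sUP FU Fs mem_cat => /esym/orP[/tB FB'|//].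
  by rewrite FB' in nFB.
have /andP[FU Fs] : (F \subset U) && (F \in s).
  by rewrite -sUP (perm_mem st) mem_cat Ft' orbT.
have [e /= /andP[eF eB]] := pred0Pn FB.
exists (F :: t), (rem F t'), (B :|: F), (u + U_(e))%MM; split.
  split; last 2 first.
  - by rewrite /= szt.
  - by apply/set0Pn; exists e; rewrite inE eB.
  apply: (perm_trans st); apply: perm_trans (_ : perm_eq _ (t ++ F :: rem F t')) _.
    by rewrite perm_cat2l perm_to_rem.
  by rewrite -cat1s perm_catCA.
split.
- move=> G; rewrite inE => /predU1P[->|/tB GB]; first exact: subsetUr.
  exact: subset_trans GB (subsetUl _ _).
- by rewrite subUset BU.
- by rewrite degmD degm1 (subsetP FU) // du addn1.
(* For [j] in [B], the new edge takes [e] and [t] takes [u] with [j]; for [j] in [F], the new edge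
   takes [j] and [t] takes [u] with [e], which is allowed as [e] is in [B]. *)
- move=> j; rewrite inE => /orP[jB|jF].
    exists e, (u + U_(j))%MM; rewrite eF; split=> //; last exact: Bu.
    by rewrite Monoid.mulmAC [RHS]addmC.
  by exists j, (u + U_(e))%MM; rewrite jF; split; [|rewrite addmC|apply: Bu].
Qed.

(** Each factor not inside [U] is served by a variable outside [U], so these factors extend the tree
    monomial without changing its [U]-degree. *)
Lemma connected_socle s U : (forall F, F \in s -> F != set0) ->
    connected_in s U ->
  exists2 v, degm U v < nsub s U &
    forall j, j \in U -> prodexp s (v + U_(j))%MM.
Proof.
move=> s_nz conn; have [u du Uu] := connected_tree s_nz conn.
have [w dw sw] : exists2 w, degm U w = 0 &
    prodexp [seq F : {set _} <- s | ~~ (F \subset U)] w.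
  elim: {conn u du Uu s_nz} s => [|F s [w dw sw]] /=.
    by exists 0%MM; rewrite // /degm big1 // => j _; rewrite mnm0E.
  case: (boolP (F \subset U)) => /= [_|]; first by exists w.
  case/subsetPn => j jF jU; exists (U_(j) + w)%MM; last by exists j, w.
  by rewrite degmD degm1 (negbTE jU) dw.
exists (u + w)%MM; first by rewrite degmD dw addn0.
by move=> j jU; rewrite Monoid.mulmAC; apply: prodexp_filter (Uu j jU) sw.
Qed.

End Monomials.

Local Open Scope ring_scope.

(** * Generated ideals *)

Section IdealGen.
Variables (R : comNzRingType) (G : set R).

Lemma ideal_gen_incl g : G g -> ideal_gen G g.
Proof.
by move=> Gg; exists 1%N, (fun=> 1), (fun=> g); split=> //; rewrite big_ord1 mul1r.
Qed.

Lemma ideal_gen0 : ideal_gen G 0.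
Proof. by exists 0%N, (fun=> 0), (fun=> 0); split=> [[]//|]; rewrite big_ord0. Qed.

Lemma ideal_genM a f : ideal_gen G f -> ideal_gen G (a * f).
Proof.
move=> [m [b [g [Gg ->]]]]; exists m, (fun i => a * b i), g; split=> //.
by rewrite mulr_sumr; apply: eq_bigr => i _; rewrite mulrA.
Qed.

Lemma ideal_genD f1 f2 : ideal_gen G f1 -> ideal_gen G f2 -> ideal_gen G (f1 + f2).
Proof.
move=> [m1 [a1 [g1 [Gg1 ->]]]] [m2 [a2 [g2 [Gg2 ->]]]].
pose glue (h1 : 'I_m1 -> R) h2 (i : 'I_(m1 + m2)) :=
  match fintype.split i with inl j => h1 j | inr j => h2 j end.
exists (m1 + m2)%N, (glue a1 a2), (glue g1 g2); split=> [i|].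
  by rewrite /glue; case: (fintype.split i).
rewrite big_split_ord /glue; congr (_ + _); apply: eq_bigr => i _.
  by rewrite (unsplitK (inl i : 'I_m1 + 'I_m2)).
by rewrite (unsplitK (inr i : 'I_m1 + 'I_m2)).
Qed.

Lemma ideal_gen_sub (P : set R) : P 0 ->
    (forall a u v, P u -> P v -> P (a * u + v)) -> (forall g, G g -> P g) ->
  forall f, ideal_gen G f -> P f.
Proof.
move=> P0 PMD GP f [m [a [g [Gg ->]]]].
by elim/big_rec: _ => // i x _ Px; apply: PMD => //; apply: GP.
Qed.

End IdealGen.

(** * Prime ideals and finite intersections *)

Section PrimeColon.
Variable R : comNzRingType.
Implicit Types (P : set R) (u v : R).

Lemma prime_idealM P : prime_ideal P -> forall u v, P (u * v) -> P u \/ P v.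
Proof.
move=> [_ primeP] u v Puv.
by have /orP[] := primeP u v (mem_set Puv) => /set_mem; [left|right].
Qed.

Lemma prime_idealX P u k : prime_ideal P -> P (u ^+ k) -> P u.
Proof.
move=> primeP; elim: k => [|k IHk].
  by have [[_ P1 _] _] := primeP; rewrite expr0 => /mem_set P1'; rewrite P1' in P1.
by rewrite exprS => /(prime_idealM primeP)[].
Qed.

Lemma prime_ideal_not1 P : prime_ideal P -> ~ P 1.
Proof. by move=> [[_ P1 _] _] /mem_set P1'; rewrite P1' in P1. Qed.

Lemma prime_idealMD P : prime_ideal P -> forall a u v, P u -> P v -> P (a * u + v).
Proof.
by move=> [[_ _ PMD] _] a u v Pu Pv; apply: set_mem; apply: PMD; apply: mem_set.
Qed.

Lemma prime_ideal0 P : prime_ideal P -> P 0.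
Proof. by move=> [[P0 _ _] _]; apply: set_mem. Qed.

(** Otherwise each [Q i] with [D i] has an element outside [P]; the product of these lies in all
    such [Q i], hence in [P], against primality. *)
Lemma prime_bigcap (T : finType) (Q : T -> set R) (D : T -> Prop) P : prime_ideal P ->
    (forall i u v, Q i u -> Q i (v * u)) ->
    (forall u, (forall i, D i -> Q i u) -> P u) ->
  exists i, D i /\ forall u, Q i u -> P u.
Proof.
move=> primeP QM QP; apply: contrapT => nQ.
have wit i : exists u, D i -> Q i u /\ ~ P u.
  case: (pselect (D i)) => [Di|nDi]; last by exists 0.
  apply: contrapT => nu; case: nQ; exists i; split=> // u Qu.
  by apply: contrapT => nPu; apply: nu; exists u.
have [u hu] := choice wit.
have : P (\prod_(i | `[< D i >]) u i).
  apply: QP => i Di; rewrite (bigD1 i) /=; last exact/asboolP.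
  by rewrite mulrC; apply: QM; apply: (hu i Di).1.
elim/big_rec: _ => [|i x /asboolP Di IH]; first exact: prime_ideal_not1.
by move/(prime_idealM primeP) => []; [apply: (hu i Di).2|apply: IH].
Qed.

End PrimeColon.

Lemma coefM_lowest (R : idomainType) (p q : {poly R}) a :
    p`_0 != 0 -> q`_a != 0 -> (forall i, (i < a)%N -> q`_i = 0) ->
  (p * q)`_a != 0.
Proof.
move=> p0 qa q0; rewrite coefM big_ord_recl /= subn0 big1 ?addr0 ?mulf_neq0 //.
by move=> i _; rewrite q0 ?mulr0 // /bump /=; have := ltn_ord i; lia.
Qed.

(** * Products of monomial primes as intersections of primary ideals *)

Section ProductIdeals.
Variables (K : fieldType) (n : nat).
Local Notation S := {mpoly K[n]}.
Implicit Types (F U : {set 'I_n}) (s t : seq {set 'I_n}) (f g : S).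

(** Testing a monomial ideal on supports turns identities between ideals into statements about
    exponents. *)
Definition prodideal s : set S := [set f | forall m, m \in msupp f -> prodexp s m].

(* The symbolic power P_U^d. *)
Definition sympow U d : set S :=
  [set f | forall m, m \in msupp f -> (d <= degm U m)%N].

Lemma msuppMD_ind (W : 'X_{1..n} -> Prop) : (forall m u, W m -> W (u + m)%MM) ->
  forall a f g, (forall m, m \in msupp f -> W m) -> (forall m, m \in msupp g -> W m) ->
  forall m, m \in msupp (a * f + g) -> W m.
Proof.
move=> Wup a f g Wf Wg m /msuppD_le; rewrite mem_cat => /orP[/msuppM_le|]; last exact: Wg.
by case/allpairsP => -[m1 m2] /= [_ /Wf Wm2 ->]; apply: Wup.
Qed.

Lemma sympowM U d f g : sympow U d f -> sympow U d (g * f).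
Proof.
move=> Uf; rewrite -[g * f]addr0.
apply: (msuppMD_ind (W := fun m => (d <= degm U m)%N)) => // [m u|m].
  by rewrite degmD => /leq_trans; apply; apply: leq_addl.
by rewrite msupp0.
Qed.

Lemma prodidealMD s a f g : prodideal s f -> prodideal s g -> prodideal s (a * f + g).
Proof.
by apply: msuppMD_ind => m u sm; rewrite addmC; apply: prodexpDr.
Qed.

Lemma prodideal0 s : prodideal s 0.
Proof. by move=> m; rewrite msupp0. Qed.

Lemma prodidealX s m : prodideal s 'X_[m] <-> prodexp s m.
Proof.
split=> [|sm u]; first by apply; rewrite msuppX mem_head.
by rewrite msuppX inE => /eqP ->.
Qed.

Lemma ideal_gen_monomials (G : set S) f :
  (forall m, m \in msupp f -> ideal_gen G 'X_[m]) -> ideal_gen G f.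
Proof.
move=> Gf; rewrite (mpolyE f) big_seq; elim/big_rec: _ => [|m x /Gf Gm Gx].
  exact: ideal_gen0.
by apply: ideal_genD => //; rewrite -mul_mpolyC; apply: ideal_genM.
Qed.

Lemma ideal_mul_prodideal s t :
  ideal_mul (prodideal s) (prodideal t) = prodideal (s ++ t).
Proof.
apply/seteqP; split=> f.
  apply: ideal_gen_sub => [|a u v|g [u su [v tv <-]]]; first exact: prodideal0.
    exact: prodidealMD.
  move=> m /msuppM_le/allpairsP[[m1 m2] /= [/su sm1 /tv tm2 ->]].
  exact: prodexp_cat.
move=> stf; apply: ideal_gen_monomials => m /stf/prodexp_catV[m1 [m2 [-> sm1 tm2]]].
apply: ideal_gen_incl; exists 'X_[m1]; first exact/prodidealX.
by exists 'X_[m2]; [exact/prodidealX|rewrite mpolyXD].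
Qed.

Lemma monomial_prime_prodideal F : @monomial_prime K n F = prodideal [:: F].
Proof.
apply/seteqP; split=> f.
  apply: ideal_gen_sub => [|a u v|g [j jF <-]]; first exact: prodideal0.
    exact: prodidealMD.
  by apply/prodidealX; exists j, 0%MM; rewrite addm0.
move=> sf; apply: ideal_gen_monomials => m /sf[j [m' [jF -> _]]].
by rewrite addmC mpolyXD; apply: ideal_genM; apply: ideal_gen_incl; exists j.
Qed.

Lemma sympow1 U : sympow U 1 = @monomial_prime K n U.
Proof.
rewrite monomial_prime_prodideal; apply/seteqP; split=> f Uf m /Uf.
  by case/degm_gt0P => j jU mj; exists j, (m - U_(j))%MM; rewrite -mnm_predK.
by move=> [j [m' [jU -> _]]]; rewrite degmD degm1 jU.
Qed.

Lemma big_ideal_mul_prodideal s :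
  \big[@ideal_mul S/classical_sets.setT]_(F <- s) @monomial_prime K n F = prodideal s.
Proof.
elim: s => [|F s IHs].
  by rewrite big_nil; apply/seteqP; split.
by rewrite big_cons IHs monomial_prime_prodideal ideal_mul_prodideal.
Qed.

Lemma ideal_exp_prodideal s k :
  ideal_exp (prodideal s) k.+1 = prodideal (flatten (nseq k.+1 s)).
Proof.
rewrite /ideal_exp iteropS; elim: k => [|k IHk]; first by rewrite /= cats0.
by rewrite iterS IHk ideal_mul_prodideal.
Qed.

(** * The grading by [U]-degree *)

Section Valuation.
Variable U : {set 'I_n}.

(* x_i is sent to t x_i if i is in U, so that the coefficient of t^d is the part
   of U-degree d. *)
Definition grade_by f : {poly S} :=
  mmap (polyC \o @mpolyC n K) (fun i => ('X_i)%:P * 'X^(i \in U)) f.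

Lemma grade_byM : {morph grade_by : f g / f * g}.
Proof. exact: rmorphM. Qed.

Lemma coef_grade_by f d :
  (grade_by f)`_d = \sum_(m <- msupp f | degm U m == d) f@_m *: 'X_[m].
Proof.
rewrite /grade_by /mmap coef_sum [RHS]big_mkcond; apply: eq_bigr => m _ /=.
have -> : mmap1 (fun i => ('X_i)%:P * 'X^(i \in U)) m =
          ('X_[m])%:P * 'X^(degm U m) :> {poly S}.
  rewrite /mmap1 mpolyXE_id rmorph_prod /degm [(\sum_(j in U) _)%N]big_mkcond.
  rewrite -prodrXr -big_split; apply: eq_bigr => i _ /=.
  by rewrite exprMn rmorphXn -exprM; case: (i \in U); rewrite ?mul1n ?mul0n.
rewrite mulrA -polyCM coefCM coefXn mul_mpolyC eq_sym.
by case: eqP => _; rewrite ?mulr1 ?mulr0.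
Qed.

Lemma mcoeff_grade_by f d m : ((grade_by f)`_d)@_m = f@_m *+ (degm U m == d).
Proof.
rewrite coef_grade_by raddf_sum /=.
under eq_bigr => u _ do rewrite mcoeffZ mcoeffX.
have [mf|mf] := boolP (m \in msupp f); last first.
  rewrite (memN_msupp_eq0 mf) mul0rn big_seq_cond big1 // => u /andP[uf _].
  by have [um|_] := eqVneq u m; rewrite ?mulr0 //; rewrite um (negbTE mf) in uf.
rewrite big_mkcond (bigD1_seq m) ?msupp_uniq //= eqxx mulr1 big1 ?addr0.
  by case: eqP.
by move=> u /negbTE um; rewrite um mulr0 if_same.
Qed.

Lemma grade_by_coef_neq0 f d :
  (grade_by f)`_d != 0 <-> exists2 m, m \in msupp f & degm U m = d.
Proof.
split=> [|[m mf <-]].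
  rewrite -msupp_eq0; case E: (msupp _) => [//|m s] _.
  have : m \in msupp (grade_by f)`_d by rewrite E mem_head.
  rewrite mcoeff_msupp mcoeff_grade_by.
  have [<-|_] := eqVneq (degm U m) d; last by rewrite eqxx.
  by rewrite -mcoeff_msupp => mf; exists m.
apply: contraTneq mf => /(congr1 (mcoeff m)); rewrite mcoeff_grade_by eqxx mcoeff0.
by move=> /eqP; rewrite mcoeff_eq0.
Qed.

(** If [g] had a monomial free of the variables of [U], [grade_by g] would have a nonzero constant
    coefficient. Multiplication by [g] would then preserve the lowest [U]-degree of [f], which is
    below [d]. *)
Lemma sympow_primary d f g :
  sympow U d (g * f) -> ~ sympow U d f -> sympow U 1 g.
Proof.
move=> Ugf nUf m0 m0g; rewrite lt0n; apply/eqP => deg_m0; apply: nUf => m mf.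
have exf : exists a, (grade_by f)`_a != 0.
  by exists (degm U m); apply/grade_by_coef_neq0; exists m.
case: (ex_minnP exf) => a fa amin.
apply: leq_trans (amin (degm U m) _); last by apply/grade_by_coef_neq0; exists m.
have : (grade_by (g * f))`_a != 0.
  rewrite grade_byM; apply: coefM_lowest => //.
    by apply/grade_by_coef_neq0; exists m0.
  move=> i ia; apply/eqP; apply: contraTT ia => /amin.
  by rewrite -leqNgt.
by move/grade_by_coef_neq0 => [u /Ugf du <-].
Qed.

End Valuation.

(** * Associated primes of products of monomial primes *)

Lemma prodideal_sympow s f :
  prodideal s f <-> forall U, connected_in s U -> sympow U (nsub s U) f.
Proof.
split=> [sf U Uc m /sf|sf m mf]; first by move/prodexpP; apply.
by apply/prodexpP => U Uc; apply: sf.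
Qed.

(** The colon by [f] distributes over the intersection of the symbolic powers, so the prime [P]
    contains one of the resulting colons. Primariness gives one inclusion between [P] and the prime
    of that [U]. *)
Lemma Ass_prodideal_sub s P : Ass (prodideal s) P ->
  exists2 U, connected_in s U & P = @monomial_prime K n U.
Proof.
move=> [primeP [f PE]].
have [U [Uc UP]] : exists U, connected_in s U /\
    forall g, sympow U (nsub s U) (g * f) -> P g.
  apply: (prime_bigcap (Q := fun U => colon (sympow U (nsub s U)) f)) => //.
    by move=> U u v Uu; rewrite /colon /= -mulrA; apply: sympowM.
  by move=> u Uu; rewrite PE; apply/prodideal_sympow.
exists U => //; apply/seteqP; split=> g.
  rewrite {1}PE -sympow1 => /prodideal_sympow/(_ U Uc) Ugf.
  apply: sympow_primary Ugf _ => Uf.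
  by apply: (prime_ideal_not1 primeP); apply: UP; rewrite mul1r.
apply: ideal_gen_sub => [|a u v|_ [j jU <-]]; first exact: prime_ideal0.
  exact: prime_idealMD.
(* The power [nsub s U] of a variable of [U] already lies in the symbolic power, hence in the
   colon. *)
apply: (@prime_idealX _ _ _ (nsub s U) primeP); apply: UP.
rewrite mulrC; apply: sympowM => m; rewrite mpolyXn msuppX inE => /eqP ->.
elim: (nsub s U) => [//|d IHd].
by rewrite mulmS degmD degm1 jU add1n ltnS.
Qed.

(** The socle monomial is the witness: a variable of [U] brings it into the ideal, while a
    multiplier of [U]-degree 0 leaves its [U]-degree below [nsub s U]. *)
Lemma monomial_prime_colon s U : (forall F, F \in s -> F != set0) ->
    connected_in s U ->
  exists f, @monomial_prime K n U = colon (prodideal s) f.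
Proof.
move=> s_nz Uc; have [v dv Uv] := connected_socle s_nz Uc.
exists 'X_[v]; rewrite -sympow1; apply/seteqP; split=> g gP m.
  rewrite (perm_mem (msuppMX _ _)) => /mapP[u ug ->].
  have /degm_gt0P[j jU uj] := gP u ug.
  by rewrite (mnm_predK uj) addmA; apply: prodexpDr; apply: Uv.
move=> mg; have /prodexp_nsub/(_ U) : prodexp s (v + m)%MM.
  by apply: gP; rewrite (perm_mem (msuppMX _ _)) map_f.
by rewrite degmD; lia.
Qed.

Lemma Ass_prodideal s P : (forall F, F \in s -> F != set0) ->
  Ass (prodideal s) P <-> prime_ideal P /\
    exists2 U, connected_in s U & P = @monomial_prime K n U.
Proof.
move=> s_nz; split=> [sP|[primeP [U Uc PE]]].
  by split; [case: sP|apply: Ass_prodideal_sub].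
by split=> //; rewrite PE; apply: monomial_prime_colon.
Qed.

(** Connectedness, which determines the associated primes, only sees which sets occur and not how
    often. *)
Lemma eq_Ass_prodideal s t : s =i t -> (forall F, F \in s -> F != set0) ->
  Ass (prodideal s) = Ass (prodideal t).
Proof.
move=> st s_nz; have t_nz F : F \in t -> F != set0 by rewrite -st; apply: s_nz.
apply/seteqP; split=> P; rewrite !Ass_prodideal // => -[primeP [U Uc PE]];
  by split=> //; exists U => //; apply: eq_connected_in Uc.
Qed.

End ProductIdeals.

(** * Stability index and stable set of a constant sequence *)

Section Stabilization.
Variables (R : comNzRingType) (I : set R).
Hypothesis AssI : forall k, (1 <= k)%N -> Ass (ideal_exp I k) = Ass I.

Lemma astab1 : astab I = 1%N.
Proof.
apply: xget_unique => [|k [[k1 _] kmin]].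
  by split=> [|k []//]; split=> // k k1; rewrite !AssI.
by apply/eqP; rewrite eqn_leq k1 andbT; apply: kmin; split=> // j j1; rewrite !AssI.
Qed.

Lemma Ass_infty_const : Ass_infty I = Ass I.
Proof.
apply: xget_unique => [|A [k0 Ak]]; first by exists 1%N.
(* The exponent [maxn 1 k0] lies in both the stable range of [A] and the range of [AssI]. *)
by rewrite -(Ak (maxn 1 k0)) ?leq_maxr // AssI ?leq_maxl.
Qed.

End Stabilization.

Theorem corollary3p6 (K : fieldType) (n : nat) (I : set {mpoly K[n]})
    (hI : transversal_polymatroidal I) :
  astab I = 1%N /\ Ass I = Ass_infty I.
Proof.
suff AssI k : (1 <= k)%N -> Ass (ideal_exp I k) = Ass I.
  by rewrite astab1 ?Ass_infty_const.
case: hI => r [F [_ F_nz ->]]; case: k => // k _.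
have -> : \big[@ideal_mul {mpoly K[n]}/classical_sets.setT]_(i < r)
            @monomial_prime K n (F i) =
          @prodideal K n [seq F i | i <- index_enum 'I_r].
  by rewrite -big_ideal_mul_prodideal big_map.
(* A power repeats the list of factors at least once, so it has the same members. *)
rewrite ideal_exp_prodideal; apply/esym/eq_Ass_prodideal.
  move=> G; apply/idP/flattenP => [Gs|[s /nseqP[-> _]//]].
  by exists [seq F i | i <- index_enum 'I_r]; rewrite ?mem_head.
by move=> _ /mapP[i _ ->].
Qed.
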